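(* Let $\mathbf P_\Theta=\{P_i^\theta : i=1,2,\ldots\}$ be a locally finite marked point set satisfying Conditions D and admitting no descending chain of Type 1. Then there exists a unique growth-maximal hard-segment model (GMHS model) of Type 1 based on $\mathbf P_\Theta$. Moreover, writing it as a function $f$ with $f(P_i^\theta)=R_i$, it is the unique solution $f\in\mathcal F$ of $T_1f=f$, where $\mathcal F$ is the space of (measurable) functions $f:\mathbf P_\Theta\to[0,\infty]$ and $T_1:\mathcal F\to\mathcal F$ is defined by $$T_1f(P_i^\theta):=\inf\{d_{ij}: P_j^\theta\in\mathbf P_\Theta\setminus\{P_i^\theta\},\ d_{ij}>d_{ji}\text{ and } f(P_j^\theta)>d_{ji}\},\qquad \inf\emptyset:=\infty .$$
   Context: A locally finite marked point set is a countable set $\mathbf P_\Theta=\{P_i^\theta\}$ with $P_i^\theta=(P_i,\theta_i)$, where the $P_i\in\mathbb R^2$ are distinct points, only finitely many in any bounded set, and $\theta_i\in[0,\pi)$ are directions. Put $u(\theta)=(\cos\theta,\sin\theta)$. For $i\ne j$: if $\theta_i\neq\theta_j$, $P_{ij}$ is the intersection point of the two infinite lines through $P_i$, $P_j$ with directions $\theta_i$, $\theta_j$, and $d_{ij}:=|P_i-P_{ij}|$, $d_{ji}:=|P_j-P_{ij}|$ (Euclidean distances). If $\theta_i=\theta_j$, then $d_{ij}=d_{ji}:=\tfrac12|P_i-P_j|$ if $P_j$ lies on the infinite line through $P_i$ with direction $\theta_i$, and $d_{ij}=d_{ji}:=\infty$ otherwise. Conditions D: all the finite values among the $d_{ij}$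 (over ordered pairs $(i,j)$, $i\ne j$) are pairwise distinct, i.e. $d_{ij}\neq d_{kl}$ whenever $(i,j)\ne(k,l)$ and both are finite. Given $R_i\in[0,\infty]$ for each $i$, let $S_i:=\{P_i+tu(\theta_i): |t|\le R_i\}$ if $R_i<\infty$ and $S_i:=\{P_i+tu(\theta_i):t\in\mathbb R\}$ if $R_i=\infty$. The relative interior of $S_i$ is $\{P_i+tR_iu(\theta_i):-1<t<1\}$ if $R_i<\infty$, and $S_i$ itself if $R_i=\infty$. The set $\{(P_i^\theta,R_i)\}$ is a hard-segment model (HS model) based on $\mathbf P_\Theta$ if for all $i\ne j$ the segments $S_i,S_j$ have disjoint relative interiors. In an HS model, distinct $P_i^\theta,P_j^\theta$ are segment neighbours if $S_i\cap S_j\ne\emptyset$. A segment neighbour $P_j^\theta$ of $P_i^\theta$ is a Type 1 stopping segment neighbour of $P_i^\theta$ if $R_i=d_{ij}$, $d_{ij}>d_{ji}$ and $R_j>d_{ji}$. An HS model is growth-maximal of Type 1 (a GMHS model of Type 1) if every $P_i^\theta$ with $R_i<\infty$ has a Type 1 stopping segment neighbour. $\mathbf P_\Theta$ has a descending chain of Type 1 if it contains an infinite sequence $P_0^\theta,P_1^\theta,\ldots$ of distinct elements with $d_{01}<\infty$ and $d_{n-1,n}\ge d_{n,n-1}\ge d_{n,n+1}$ for all $n\ge1$ (here $d_{n,m}$ refers to the pair $P_n^\theta,P_m^\theta$ of the sequence). *)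

(* Defs.v *)
From HB Require Import structures.
From mathcomp Require Import all_boot all_order all_algebra.
From mathcomp Require Import all_classical all_reals all_analysis.
Set Implicit Arguments.
Unset Strict Implicit.
Unset Printing Implicit Defensive.
Import Order.TTheory GRing.Theory Num.Theory.
Import numFieldNormedType.Exports.
Local Open Scope classical_set_scope.
Local Open Scope ring_scope.

(* Euclidean distance; the library norm on R * R is the sup norm. *)
Definition eucl_dist (R : realType) (p q : R * R) : R :=
  Num.sqrt ((p.1 - q.1) ^+ 2 + (p.2 - q.2) ^+ 2).

Definition udir (R : realType) (theta : R) : R * R := (cos theta, sin theta).

(* A marked point set is given as a family X i = (P_i, theta_i) of marked
   points with pairwise distinct locations P_i.  The index type is countable,
   hence either finite or in bijection with nat. *)
Definition pt (R : realType) (I : Type) (X : I -> (R * R) * R) (i : I) : R * R :=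
  (X i).1.
Definition dir (R : realType) (I : Type) (X : I -> (R * R) * R) (i : I) : R :=
  (X i).2.

(* bounded_set refers to the sup norm, which has the same bounded sets as the
   Euclidean one. *)
Definition locally_finite_marked (R : realType) (I : countType)
    (X : I -> (R * R) * R) : Prop :=
  [/\ injective (pt X),
      forall i, 0 <= dir X i < pi
    & forall B : set (R * R), bounded_set B -> finite_set [set i | B (pt X i)]].

Definition line (R : realType) (I : Type) (X : I -> (R * R) * R) (i : I)
    : set (R * R) :=
  [set pt X i + t *: udir (dir X i) | t in [set: R]].

(* The common point of the two lines.  It is unique when the directions differ,
   and is only used in that case. *)
Definition crossing (R : realType) (I : Type) (X : I -> (R * R) * R) (i j : I)
    : R * R :=
  get (line X i `&` line X j).

Definition dij (R : realType) (I : Type) (X : I -> (R * R) * R) (i j : I)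
    : \bar R :=
  if dir X i == dir X j then
    if pt X j \in line X i then (eucl_dist (pt X i) (pt X j) / 2)%:E else +oo%E
  else (eucl_dist (pt X i) (crossing X i j))%:E.

Definition conditions_D (R : realType) (I : Type) (X : I -> (R * R) * R)
    : Prop :=
  forall i j k l : I, i <> j -> k <> l -> (i, j) <> (k, l) ->
    (dij X i j < +oo)%E -> (dij X k l < +oo)%E -> dij X i j <> dij X k l.

Definition descending_chain1 (R : realType) (I : Type) (X : I -> (R * R) * R)
    : Prop :=
  exists s : nat -> I,
    [/\ injective s,
        (dij X (s 0%N) (s 1%N) < +oo)%E
      & forall n : nat, (1 <= n)%N ->
          (dij X (s n.-1) (s n) >= dij X (s n) (s n.-1))%E /\
          (dij X (s n) (s n.-1) >= dij X (s n) (s n.+1))%E].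

(* The space of functions from the marked point set to [0, +oo].  No
   measurability is imposed: the marked point set is countable, so every such
   function is measurable. *)
Definition radius_functions (R : realType) (I : Type) : set (I -> \bar R) :=
  [set r | forall i, (0 <= r i)%E].

Definition segment (R : realType) (I : Type) (X : I -> (R * R) * R)
    (r : I -> \bar R) (i : I) : set (R * R) :=
  if r i == +oo%E then line X i
  else [set pt X i + t *: udir (dir X i) | t in [set t : R | `|t| <= fine (r i)]].

(* For r i = 0 this is the single point P_i, not the empty set. *)
Definition rel_interior (R : realType) (I : Type) (X : I -> (R * R) * R)
    (r : I -> \bar R) (i : I) : set (R * R) :=
  if r i == +oo%E then line X i
  else [set pt X i + (t * fine (r i)) *: udir (dir X i)
           | t in [set t : R | -1 < t < 1]].

Definition HS_model (R : realType) (I : Type) (X : I -> (R * R) * R)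
    (r : I -> \bar R) : Prop :=
  radius_functions r /\
  forall i j : I, i <> j -> rel_interior X r i `&` rel_interior X r j = set0.

Definition segment_neighbours (R : realType) (I : Type) (X : I -> (R * R) * R)
    (r : I -> \bar R) (i j : I) : Prop :=
  i <> j /\ segment X r i `&` segment X r j !=set0.

(* j is a Type 1 stopping segment neighbour of i *)
Definition stopping1 (R : realType) (I : Type) (X : I -> (R * R) * R)
    (r : I -> \bar R) (i j : I) : Prop :=
  [/\ segment_neighbours X r i j,
      r i = dij X i j,
      (dij X i j > dij X j i)%E
    & (r j > dij X j i)%E].

Definition GMHS1 (R : realType) (I : Type) (X : I -> (R * R) * R)
    (r : I -> \bar R) : Prop :=
  HS_model X r /\
  forall i, (r i < +oo)%E -> exists j, stopping1 X r i j.

(* ereal_inf set0 = +oo *)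
Definition T1 (R : realType) (I : Type) (X : I -> (R * R) * R)
    (f : I -> \bar R) : I -> \bar R :=
  fun i => ereal_inf
    [set dij X i j | j in [set j | [/\ j <> i, (dij X i j > dij X j i)%E
                                     & (f j > dij X j i)%E]]].

Lemma dij_ge0 (R : realType) (I : Type) (X : I -> (R * R) * R) (i j : I) :
  (0 <= dij X i j)%E.
Proof.
rewrite /dij; case: ifP => _; last by rewrite lee_fin sqrtr_ge0.
by case: ifP => _ //; rewrite lee_fin divr_ge0 // sqrtr_ge0.
Qed.

Lemma T1_radius_functions (R : realType) (I : Type) (X : I -> (R * R) * R)
    (f : I -> \bar R) :
  radius_functions f -> radius_functions (T1 X f).
Proof.
by move=> _ i; apply: le_ereal_inf_tmp => _ [j _ <-]; exact: dij_ge0.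
Qed.

(* Main.v *)
(** For [stoppable i j], i.e. [d_ij > d_ji], whether [f j > d_ji] holds for a
    solution [f] of [T1 f = f] depends, since infima of the [d_jk] are attained
    by local finiteness, only on whether [f k > d_kj] holds for the [k] with
    [d_jk > d_kj] and [d_jk < d_ji].  This dependency is well founded: an
    infinite dependency path is a walk with decreasing distances, which visits
    each point finitely often by local finiteness, so that erasing its loops
    gives a descending chain of Type 1.  Well-founded recursion thus yields
    exactly one solution.  Solutions are GMHS models of Type 1 and conversely,
    because two segments cross in their relative interiors exactly when their
    radii exceed [d_ij] and [d_ji], as long as the radii are positive. *)
Require Import Defs.
From mathcomp Require Import all_boot all_order all_algebra.
From mathcomp Require Import all_classical all_reals all_analysis.
From mathcomp Require Import ring lra.
Import Order.TTheory GRing.Theory Num.Theory.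
Import numFieldNormedType.Exports.
Local Open Scope classical_set_scope.
Local Open Scope ring_scope.

(** * Crossings of lines and segments in the plane *)

Section Geometry.
Set Implicit Arguments.
Unset Strict Implicit.
Variables (R : realType) (I : Type) (X : I -> (R * R) * R).
Local Notation point_on i t := (pt X i + t *: udir (dir X i)).

Lemma eucl_dist_ray (p : R * R) (t a : R) :
  eucl_dist p (p + t *: udir a) = `|t|.
Proof.
rewrite /eucl_dist /= -sqrtr_sqr; congr Num.sqrt.
rewrite -[RHS]mulr1 -(cos2Dsin2 a) /GRing.scale /=; ring.
Qed.

Lemma sin_sub_neq0 (a b : R) : 0 <= a < pi -> 0 <= b < pi -> a != b ->
  sin (a - b) != 0.
Proof.
move=> /andP[a0 api] /andP[b0 bpi]; case: ltgtP => // ab _.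
  rewrite -opprB sinN oppr_eq0 gt_eqF// sin_gt0_pi//; lra.
by rewrite gt_eqF// sin_gt0_pi//; lra.
Qed.

(** The cross product with [udir (dir X j)] eliminates [s]. *)
Lemma crossing_coord (i j : I) (t s : R) : point_on i t = point_on j s ->
  sin (dir X i - dir X j) * t =
    ((pt X j).2 - (pt X i).2) * cos (dir X j)
    - ((pt X j).1 - (pt X i).1) * sin (dir X j).
Proof.
case=> e1 e2; rewrite /GRing.scale /= in e1 e2; rewrite sinB.
have -> : (pt X j).2 = (pt X i).2 + t * sin (dir X i) - s * sin (dir X j).
  by rewrite e2; ring.
have -> : (pt X j).1 = (pt X i).1 + t * cos (dir X i) - s * cos (dir X j).
  by rewrite e1; ring.
ring.
Qed.

Lemma crossing_exists (i j : I) : sin (dir X i - dir X j) != 0 ->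
  exists t s, point_on i t = point_on j s.
Proof.
set D := sin _ => D0.
set x := (pt X j).1 - (pt X i).1; set y := (pt X j).2 - (pt X i).2.
(* Cramer's rule for [t *: udir (dir X i) - s *: udir (dir X j) = (x, y)]. *)
exists ((y * cos (dir X j) - x * sin (dir X j)) / D).
exists ((y * cos (dir X i) - x * sin (dir X i)) / D).
rewrite {1}(surjective_pairing (pt X i)) (surjective_pairing (pt X j)).
have e1 : (pt X j).1 = (pt X i).1 + x by rewrite /x; ring.
have e2 : (pt X j).2 = (pt X i).2 + y by rewrite /y; ring.
rewrite e1 e2 /udir.
congr (_, _) => /=; rewrite -addrA; congr (_ + _); apply: (mulfI D0);
  rewrite /GRing.scale /= mulrDr !mulrA !(mulrAC D _ D^-1) divff // !mul1r
    /D sinB; ring.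
Qed.

(** Directions are unit vectors, so distances are absolute values of signed line parameters, which
    replace [crossing] from here on. *)
Lemma dij_diff_dir (i j : I) :
  0 <= dir X i < pi -> 0 <= dir X j < pi -> dir X i != dir X j ->
  exists t s, [/\ point_on i t = point_on j s,
    dij X i j = `|t|%:E, dij X j i = `|s|%:E &
    forall t' s', point_on i t' = point_on j s' -> t' = t /\ s' = s].
Proof.
move=> hi hj hij.
have Dij := sin_sub_neq0 hi hj hij.
have Dji : sin (dir X j - dir X i) != 0
  by apply: sin_sub_neq0; rewrite 1?eq_sym.
have uniq_ij t s t' s' : point_on i t = point_on j s ->
    point_on i t' = point_on j s' -> t' = t /\ s' = s.
  move=> e e'; split.
    by apply: (mulfI Dij); rewrite (crossing_coord e) (crossing_coord e').
  by apply: (mulfI Dji); rewrite (crossing_coord (esym e))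
    (crossing_coord (esym e')).
have [t [s e]] := crossing_exists Dij.
exists t, s; split => //; last by move=> *; apply: uniq_ij e _.
- rewrite /dij (negbTE hij).
  suff -> : crossing X i j = point_on i t by rewrite eucl_dist_ray.
  apply: get_subset1; first by split; [exists t | exists s].
  move=> _ q [[t1 _ <-] [s1 _ e1]] [[t2 _ e2] [s2 _ e3]].
  have [-> _] := uniq_ij _ _ _ _ e (esym e1).
  by have [<- _] := uniq_ij _ _ _ _ e (etrans e2 (esym e3)).
- rewrite /dij eq_sym (negbTE hij).
  suff -> : crossing X j i = point_on j s by rewrite eucl_dist_ray.
  apply: get_subset1; first by split; [exists s | exists t].
  move=> _ q [[s1 _ <-] [t1 _ e1]] [[s2 _ e2] [t2 _ e3]].
  have [_ ->] := uniq_ij _ _ _ _ e e1.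
  by have [_ <-] := uniq_ij _ _ _ _ e (etrans e3 (esym e2)).
Qed.

(** Points on a common line would have [dij X i j = dij X j i] finite, against Conditions D; so
    equal directions force disjoint parallel lines. *)
Lemma dij_same_dir (i j : I) : conditions_D X -> i <> j ->
  dir X i = dir X j ->
  dij X i j = +oo%E /\ line X i `&` line X j = set0.
Proof.
move=> hD ij e.
have notin : ~ line X i (pt X j).
  case=> t _ et.
  have h1 : pt X j \in line X i by rewrite inE; exists t.
  have h2 : pt X i \in line X j.
    by rewrite inE; exists (- t) => //; rewrite -et -e scaleNr addrK.
  have d1 : dij X i j = (eucl_dist (pt X i) (pt X j) / 2)%:E.
    by rewrite /dij e eqxx h1.
  have d2 : dij X j i = (eucl_dist (pt X j) (pt X i) / 2)%:E.
    by rewrite /dij e eqxx h2.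
  apply: (hD i j j i) => //.
  - by move=> eji; apply: ij.
  - by case=> /ij.
  - by rewrite d1 ltry.
  - by rewrite d2 ltry.
  - by rewrite d1 d2 /eucl_dist; congr (Num.sqrt _ / 2)%:E; ring.
split; first by rewrite /dij e eqxx ifF //; apply/negbTE; rewrite notin_setE.
apply/seteqP; split => // p [[t _ et] [s _ es]]; apply: notin.
by exists (t - s) => //; rewrite scalerBl addrA et e -es addrK.
Qed.

Lemma dij_gt_diff_dir (i j : I) : conditions_D X -> i <> j ->
  (dij X j i < dij X i j)%E -> dir X i != dir X j.
Proof.
move=> hD ij; apply: contraTneq => e.
have [-> _] := dij_same_dir hD ij e.
have [-> _] := dij_same_dir hD (nesym ij) (esym e).
by rewrite ltxx.
Qed.

Lemma rel_interior_point (r : I -> \bar R) (i : I) (t : R) :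
  (`|t|%:E < r i)%E -> rel_interior X r i (point_on i t).
Proof.
rewrite /rel_interior; case: (r i) => [x||] //=; last by move=> _; exists t.
rewrite lte_fin => tx.
have x0 : 0 < x by apply: le_lt_trans tx.
exists (t / x); last by rewrite divfK ?gt_eqF.
by rewrite /= -ltr_norml normrM normfV (gtr0_norm x0) ltr_pdivrMr // mul1r.
Qed.

(* Positivity matters: for [r i = 0] the relative interior is [{P_i}]. *)
Lemma rel_interior_inv (r : I -> \bar R) (i : I) (p : R * R) : (0 < r i)%E ->
  rel_interior X r i p -> exists2 t, (`|t|%:E < r i)%E & point_on i t = p.
Proof.
rewrite /rel_interior; case: (r i) => [x||] //= r0.
  move=> [t /= t1 <-]; exists (t * x) => //.
  rewrite lte_fin in r0; rewrite lte_fin normrM (gtr0_norm r0).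
  by rewrite -ltr_pdivlMr // divff ?gt_eqF // ltr_norml.
by move=> [t _ <-]; exists t => //; rewrite ltry.
Qed.

Lemma segment_point (r : I -> \bar R) (i : I) (t : R) :
  (`|t|%:E <= r i)%E -> segment X r i (point_on i t).
Proof.
rewrite /segment; case: (r i) => [x||] //=; last by move=> _; exists t.
by rewrite lee_fin => tx; exists t.
Qed.

Lemma rel_interior_meet (r : I -> \bar R) (i j : I) :
  0 <= dir X i < pi -> 0 <= dir X j < pi -> dir X i != dir X j ->
  (dij X i j < r i)%E -> (dij X j i < r j)%E ->
  rel_interior X r i `&` rel_interior X r j !=set0.
Proof.
move=> hi hj hij; have [t [s [e -> -> _]]] := dij_diff_dir hi hj hij => ti sj.
exists (point_on i t); split; first exact: rel_interior_point.
by rewrite e; exact: rel_interior_point.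
Qed.

Lemma segment_meet (r : I -> \bar R) (i j : I) :
  0 <= dir X i < pi -> 0 <= dir X j < pi -> dir X i != dir X j ->
  (dij X i j <= r i)%E -> (dij X j i <= r j)%E ->
  segment X r i `&` segment X r j !=set0.
Proof.
move=> hi hj hij; have [t [s [e -> -> _]]] := dij_diff_dir hi hj hij => ti sj.
exists (point_on i t); split; first exact: segment_point.
by rewrite e; exact: segment_point.
Qed.

Lemma dij_lt_radius (r : I -> \bar R) (i j : I) :
  conditions_D X -> i <> j -> 0 <= dir X i < pi -> 0 <= dir X j < pi ->
  (0 < r i)%E -> (0 < r j)%E ->
  rel_interior X r i `&` rel_interior X r j !=set0 ->
  [/\ dir X i != dir X j, (dij X i j < r i)%E & (dij X j i < r j)%E].
Proof.
move=> hD ij hi hj ri rj [p []] /(rel_interior_inv ri) [t ti et].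
move=> /(rel_interior_inv rj) [s sj es].
have hij : dir X i != dir X j.
  apply/eqP => e; have [_] := dij_same_dir hD ij e.
  by move/seteqP => [+ _] => /(_ p); apply; split; [exists t | exists s].
have [t' [s' [_ -> -> uniq_ts]]] := dij_diff_dir hi hj hij.
by have [<- <-] := uniq_ts _ _ (etrans et (esym es)).
Qed.

(** The path from P_i to P_j through the crossing has two legs of length at most [r]. Bounded
    distances thus give a bounded set, ready for local finiteness. *)
Lemma norm_pt_le (i j : I) (r : R) :
  0 <= dir X i < pi -> 0 <= dir X j < pi -> dir X i != dir X j ->
  (dij X i j <= r%:E)%E -> (dij X j i <= r%:E)%E ->
  `|pt X j| <= `|pt X i| + (r + r).
Proof.
move=> hi hj hij; have [t [s [e -> -> _]]] := dij_diff_dir hi hj hij.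
rewrite !lee_fin => tr sr.
have norm_udir a : `|udir a : R * R| <= 1.
  by rewrite prod_normE ge_max /= cos_max sin_max.
have -> : pt X j = pt X i + (t *: udir (dir X i) - s *: udir (dir X j)).
  by rewrite addrA e addrK.
apply: (le_trans (ler_normD _ _)); rewrite lerD2l.
apply: (le_trans (ler_normB _ _)); rewrite !normrZ.
by apply: lerD; [apply: le_trans tr | apply: le_trans sr]; apply: ler_piMr.
Qed.
End Geometry.

(** * Attained infima and the dependency between stopping pairs *)

Section Combinatorics.
Set Implicit Arguments.
Unset Strict Implicit.

Lemma finite_argmin (T : choiceType) (d : Order.disp_t) (O : orderType d)
    (f : T -> O) (F : set T) : finite_set F -> F !=set0 ->
  exists2 x, F x & forall y, F y -> (f x <= f y)%O.
Proof.
move=> /finite_seqP [s ->]; elim: s => [[] //|a s IH _].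
case: (pselect ([set` s] !=set0)) => [/IH [x xs xmin]|s0].
  case: (leP (f a) (f x)) => ax.
    exists a => [/=|y /=]; first exact: mem_head.
    by rewrite in_cons => /predU1P [->//|/xmin]; apply: le_trans.
  exists x => [/=|y /=]; first by rewrite in_cons; apply/orP; right.
  by rewrite in_cons => /predU1P [->|/xmin//]; exact: ltW.
exists a => [/=|y /=]; first exact: mem_head.
by rewrite in_cons => /predU1P [->//|ys]; case: s0; exists y.
Qed.

Variables (R : realType) (I : countType) (X : I -> (R * R) * R).
Hypothesis hX : locally_finite_marked X.
Hypothesis hD : conditions_D X.

Definition stoppable (i j : I) : Prop := j <> i /\ (dij X j i < dij X i j)%E.

Lemma dir_bound i : 0 <= dir X i < pi. Proof. by case: hX. Qed.

Lemma stoppable_dir i j : stoppable i j -> dir X i != dir X j.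
Proof. by case=> ji; apply: dij_gt_diff_dir => // /esym. Qed.

Lemma stoppable_fin i j : stoppable i j -> (dij X i j < +oo)%E.
Proof.
move=> /stoppable_dir h.
have [t [s [_ -> _ _]]] := dij_diff_dir (dir_bound i) (dir_bound j) h.
exact: ltry.
Qed.

Lemma stoppable_finite i (r : \bar R) : (r < +oo)%E ->
  finite_set [set j | stoppable i j /\ (dij X i j <= r)%E].
Proof.
case: r => [r _|//|_].
- have [_ _ lf] := hX.
  apply: sub_finite_set (lf [set p : R * R | `|p| <= `|pt X i| + (r + r)] _).
    move=> j /= [sij dr]; apply: norm_pt_le => //; try exact: dir_bound.
      exact: stoppable_dir.
    by apply: le_trans dr; case: sij => _ /ltW.
  exists (`|pt X i| + (r + r)); split; first exact: num_real.
  by move=> M ltM p /= hp; apply: le_trans (ltW ltM).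
- apply: (@sub_finite_set _ _ set0); last exact: finite_set0.
  move=> j /= [_].
  by rewrite leeNy_eq => /eqP e; have := dij_ge0 X i j; rewrite e.
Qed.

(** [T1] with the test [dij X j i < f j] abstracted to a relation: [A i j] reads as j growing far
    enough to block i. *)
Definition stop_inf (A : I -> I -> Prop) (i : I) : \bar R :=
  ereal_inf [set dij X i j | j in [set j | stoppable i j /\ A i j]].

Lemma stop_inf_attained A i : (stop_inf A i < +oo)%E ->
  exists2 j, stoppable i j /\ A i j & stop_inf A i = dij X i j.
Proof.
move=> /ereal_inf_lt [_ [j0 [s0 A0] <-]] fin0.
pose F := [set j | [/\ stoppable i j, A i j & (dij X i j <= dij X i j0)%E]].
have finF : finite_set F.
  by apply: sub_finite_set (stoppable_finite i fin0) => j [].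
have [|j [sj Aj j0j] jmin] := finite_argmin (dij X i) finF.
  by exists j0; split.
exists j => //; apply/eqP; rewrite eq_le; apply/andP; split.
  by apply: ereal_inf_lbound; exists j.
apply: le_ereal_inf_tmp => _ [k [sk Ak] <-].
case: (leP (dij X i k) (dij X i j0)) => [kj0|/ltW]; first exact: jmin.
exact: le_trans.
Qed.

(** Attainment of the infimum is what makes the strict inequality follow from the absence of
    competitors. *)
Lemma lt_stop_inf A i x : (x < +oo)%E ->
  (x < stop_inf A i)%E <->
  ~ exists j, [/\ stoppable i j, A i j & (dij X i j <= x)%E].
Proof.
move=> xoo; split.
  move=> xA [j [sj Aj jx]]; move: xA; apply/negP; rewrite -leNgt.
  by apply: le_trans jx; apply: ereal_inf_lbound; exists j.
move=> nA; rewrite ltNge; apply/negP => Ax; apply: nA.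
have [j [sj Aj] e] := stop_inf_attained (le_lt_trans Ax xoo).
by exists j; split => //; rewrite -e.
Qed.

Lemma T1E f : T1 X f = stop_inf (fun i j => dij X j i < f j)%E.
Proof.
apply/funext => i; rewrite /T1 /stop_inf; congr ereal_inf.
by apply/seteqP; split => y [j];
  [case=> a b c <- | case=> -[a b] c <-]; exists j.
Qed.

(** The pair (j, k) lies below (i, j) when k may stop j before j reaches its crossing with i. *)
Definition next_stop (q p : I * I) : Prop :=
  [/\ q.1 = p.2, stoppable q.1 q.2, stoppable p.1 p.2
    & (dij X q.1 q.2 < dij X p.2 p.1)%E].

(** Conditions D exclude equality unless [k = i], and then i and j would each be stoppable by the
    other. *)
Lemma stoppable_lt i j k : stoppable i j -> stoppable j k ->
  (dij X j k <= dij X j i)%E -> (dij X j k < dij X j i)%E.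
Proof.
move=> sij sjk; have [ji dji] := sij; have [kj dkj] := sjk.
rewrite le_eqVlt => /predU1P [e|//]; exfalso; move: e.
apply: hD => //; first exact: nesym.
- by case=> ki; move: dkj; rewrite ki ltNge (ltW dji).
- exact: stoppable_fin.
- exact: lt_trans dji (stoppable_fin sij).
Qed.

(** The equation [T1 f = f] restated for the relation [dij X j i < f j]. *)
Definition stopping_rule (A : I -> I -> Prop) : Prop := forall i j,
  stoppable i j -> A i j <-> ~ exists2 k, next_stop (j, k) (i, j) & A j k.

Lemma lt_stop_inf_next A i j : stoppable i j ->
  (dij X j i < stop_inf A j)%E <->
  ~ exists2 k, next_stop (j, k) (i, j) & A j k.
Proof.
move=> sij; have dfin := lt_trans sij.2 (stoppable_fin sij).
apply: (iff_trans (lt_stop_inf A j dfin)); split => h.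
  move=> [k [? sjk ? /ltW jk] Ak]; apply: h; exists k; split => //.
move=> [k [sjk Ak jk]]; apply: h; exists k => //; split => //.
exact: stoppable_lt.
Qed.

Hypothesis hchain : ~ descending_chain1 X.

(** * Loop erasure in infinite walks with decreasing distances *)

Section Walk.
Variable s : nat -> I.
Hypothesis s_stop : forall n, stoppable (s n) (s n.+1).
Hypothesis s_lt : forall n,
  (dij X (s n.+1) (s n.+2) < dij X (s n.+1) (s n))%E.

Lemma walk_decreasing m n : (m < n)%N ->
  (dij X (s n) (s n.+1) < dij X (s m) (s m.+1))%E.
Proof.
pose a n := dij X (s n) (s n.+1); rewrite -/(a n) -/(a m).
move: m n; apply: (@homo_ltn _ a (fun x y => (y < x)%E)).
  by move=> y x z xy yz; apply: lt_trans xy.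
by move=> n; apply: lt_trans (s_lt n) _; case: (s_stop n).
Qed.

(** Decreasing distances make the steps leaving [v] distinct, and they lead into the finite set of
    stoppers of [v] within the first distance. *)
Lemma walk_visits_finite v : finite_set [set n | s n = v].
Proof.
pose F := [set j | stoppable v j /\ (dij X v j <= dij X (s 0%N) (s 1%N))%E].
have finF : finite_set F by apply: stoppable_finite; apply: stoppable_fin.
pose e n := (s n, s n.+1).
have e_inj : injective e.
  move=> m n [emn emn1].
  by case: (ltngtP m n) => // /walk_decreasing; rewrite emn emn1 ltxx.
have := finite_preimage (in2W e_inj) (finite_setX (finite_set1 v) finF).
apply: sub_finite_set => n /= snv; split => //; rewrite /F /= -snv; split => //.
by case: n snv => // n _; exact/ltW/walk_decreasing.
Qed.

Lemma last_visit m : exists2 n, s n = s m & forall k, s k = s m -> (k <= n)%N.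
Proof.
(* A minimum in the dual order is the last visit. *)
have [|n sn nmax] :=
  @finite_argmin nat _ _ (fun n => n : nat^d) _ (walk_visits_finite (s m)).
  by exists m.
by exists n => // k /nmax; rewrite leEdual.
Qed.

(* Loop erasure: after each step, jump to the last visit of the point reached.
   The distances still decrease along the jumps. *)
Lemma walk_descending_chain : descending_chain1 X.
Proof.
have /choice [L HL] : forall m, exists n,
    s n = s m /\ forall k, s k = s m -> (k <= n)%N.
  by move=> m; have [n] := last_visit m; exists n.
pose t := fix t n := if n is m.+1 then L (t m).+1 else L 0%N.
have tlast n k : s k = s (t n) -> (k <= t n)%N.
  by case: n => [|n] /=; [have [-> h] := HL 0%N | have [-> h] := HL (t n).+1];
    exact: h.
have tS n : s (t n.+1) = s (t n).+1 by case: (HL (t n).+1).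
have tlt n : (t n < t n.+1)%N by have [_ h] := HL (t n).+1; exact: h.
clearbody t.
have tincr : {homo t : m n / (m < n)%N}.
  by apply: homo_ltn => //; exact: ltn_trans.
exists (s \o t); split.
- move=> m n /= emn; case: (ltngtP m n) => // /tincr.
    by rewrite ltnNge tlast.
  by rewrite ltnNge tlast.
- by rewrite /= tS; apply: stoppable_fin.
case=> // n _; rewrite /= !tS.
split; first by case: (s_stop (t n)) => _ /ltW.
(* Leaving at the last visit rather than at once can only shorten the outgoing step. *)
apply: (@le_trans _ _ (dij X (s (t n).+1) (s (t n).+2))); last exact/ltW/s_lt.
rewrite -tS; have := tlt n; rewrite leq_eqVlt => /predU1P [->//|].
by rewrite tS => /walk_decreasing/ltW; rewrite !tS.
Qed.
End Walk.

(** A non-accessible pair has a non-accessible pair below it; dependent choice then yields a walk,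
    hence a forbidden chain. *)
Lemma next_stop_wf : well_founded next_stop.
Proof.
apply: contrapT => nwf.
have /existsNP [p0 np0] : ~ forall p, Acc next_stop p by [].
pose T := {p | ~ Acc next_stop p}.
have step (x : T) : {y : T | next_stop (sval y) (sval x)}.
  apply: cid; case: x => x nx /=; apply: contra_notP nx => h.
  apply: Acc_intro => y yx; apply: contrapT => ny.
  by apply: h; exists (exist _ y ny).
have [f [f0 fS]] := dependent_choice step (exist _ p0 np0).
pose s n := (sval (f n)).1.
have sE n : s n.+1 = (sval (f n)).2 by case: (fS n).
apply: hchain; apply: (@walk_descending_chain s).
  by move=> n; case: (fS n) => _ _ + _; rewrite sE.
by move=> n; case: (fS n) => _ _ _; rewrite -!sE.
Qed.

(** * The stopping rule by well-founded recursion *)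

Lemma stopping_rule_exists : exists A, stopping_rule A.
Proof.
(* The recursive call needs a proof [h]; the first conjunct supplies one, so the universal binder
   loses nothing. *)
pose F (p : I * I) (rec : forall q, next_stop q p -> Prop) : Prop :=
  ~ exists2 k, next_stop (p.2, k) p & forall h : next_stop (p.2, k) p, rec _ h.
pose A := Fix next_stop_wf (fun=> Prop) F.
exists (fun i j => A (i, j)) => i j _.
have -> : A (i, j) = F (i, j) (fun q _ => A q).
  rewrite {1}/A Fix_eq // => p f g fg; suff -> : f = g by [].
  by do 2 (apply: functional_extensionality_dep => ?); exact: fg.
by split; apply: contra_not => -[k jk Ak]; exists k => //; apply: Ak.
Qed.

Lemma stopping_rule_unique A B i j : stopping_rule A -> stopping_rule B ->
  stoppable i j -> A i j <-> B i j.
Proof.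
move=> rA rB; have [p] : exists p, p = (i, j) by exists (i, j).
elim/(well_founded_ind next_stop_wf): p i j => p IH i j pE sij.
apply: iff_trans (rA _ _ sij) _; apply: iff_trans (iff_sym (rB _ _ sij)).
have AB k : next_stop (j, k) (i, j) -> A j k <-> B j k.
  by move=> jk; apply: (IH (j, k)) => //; [rewrite pE | case: jk].
by split; apply: contra_not => -[k jk h]; exists k => //; apply/(AB _ jk).
Qed.

Lemma eq_stop_inf A B : (forall i j, stoppable i j -> A i j <-> B i j) ->
  stop_inf A = stop_inf B.
Proof.
move=> AB; apply/funext => i; congr ereal_inf.
by apply/seteqP; split => _ [j [sij /AB h] <-]; exists j => //; split => //;
  apply: h.
Qed.

(** * Fixed points of [T1] and their match with GMHS models *)

Lemma T1_fixpoint :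
  exists f, unique (fun g => radius_functions g /\ T1 X g = g) f.
Proof.
have [A rA] := stopping_rule_exists.
have fixE i j : stoppable i j -> (dij X j i < stop_inf A j)%E <-> A i j.
  move=> sij.
  exact: iff_trans (lt_stop_inf_next A sij) (iff_sym (rA _ _ sij)).
have fixA : T1 X (stop_inf A) = stop_inf A by rewrite T1E; exact: eq_stop_inf.
exists (stop_inf A); split.
  by split => // i; apply: le_ereal_inf_tmp => _ [j _ <-]; exact: dij_ge0.
(* The relation [dij X j i < g j] obeys the rule too, so it agrees with [A] wherever [stop_inf]
   looks. *)
move=> g [_ gE]; rewrite -gE T1E; apply: eq_stop_inf => i j.
apply: (@stopping_rule_unique _ (fun i j => (dij X j i < g j)%E)) => //.
move=> {}i {}j sij.
rewrite -{1}gE T1E; exact: lt_stop_inf_next.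
Qed.

(** The infimum is attained at some [dij X i j > dij X j i >= 0], or is infinite. This rules out
    degenerate relative interiors. *)
Lemma T1_fixpoint_gt0 f i : T1 X f = f -> (0 < f i)%E.
Proof.
move=> <-; rewrite T1E; apply/lt_stop_inf => // -[j [sij _]].
by apply/negP; rewrite -ltNge; apply: le_lt_trans sij.2; exact: dij_ge0.
Qed.

(** If interiors met, the larger of the two distances, distinct by Conditions D, would bound the
    radius of its point. An attained infimum supplies the stopping neighbour. *)
Lemma T1_fixpoint_GMHS1 f : T1 X f = f -> GMHS1 X f.
Proof.
move=> fE; have f0 i := T1_fixpoint_gt0 i fE.
have no_crossing i j : stoppable i j ->
    (dij X i j < f i)%E -> (dij X j i < f j)%E -> False.
  move=> sij; rewrite -{1}fE T1E => /lt_stop_inf h fj.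
  by apply: h; [exact: stoppable_fin | exists j].
split; first split.
- by move=> i; exact: ltW.
- move=> i j ij; apply: contrapT => /eqP/set0P.
  move/(dij_lt_radius hD ij (dir_bound i) (dir_bound j) (f0 i) (f0 j)).
  move=> [dirij di dj].
  case: (ltgtP (dij X i j) (dij X j i)) => [lt|lt|].
  + by apply: (no_crossing j i) => //; split.
  + by apply: (no_crossing i j) => //; split => //; exact: nesym.
  + have [t [s [_ dt ds _]]] := dij_diff_dir (dir_bound i) (dir_bound j) dirij.
    apply: hD => //; [exact: nesym | by case |  |].
      by rewrite dt ltry.
    by rewrite ds ltry.
- move=> i; rewrite -{1}fE T1E => /stop_inf_attained [j [sij fj] e].
  rewrite -T1E fE in e; exists j; split => //; last by case: sij.
  split; first by case: sij => /nesym.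
  apply: segment_meet (dir_bound i) (dir_bound j) (stoppable_dir sij) _ (ltW fj).
  by rewrite e.
Qed.

(** The stopping neighbour bounds the infimum by [f i]; a radius beyond some candidate distance
    would make two interiors meet. *)
Lemma GMHS1_T1_fixpoint f : GMHS1 X f -> T1 X f = f.
Proof.
move=> [[_ disj] gm]; rewrite T1E; apply/funext => i; apply/eqP.
rewrite eq_le; apply/andP; split.
  have [->|/eqP fi] := pselect (f i = +oo%E); first exact: leey.
  have [|j [[ij _] -> dji fj]] := gm i; first by rewrite ltey.
  by apply: ereal_inf_lbound; exists j => //; split => //; split => //;
    exact: nesym.
apply: le_ereal_inf_tmp => _ [j [sij fj] <-]; rewrite leNgt; apply/negP => fi.
have := rel_interior_meet (dir_bound i) (dir_bound j) (stoppable_dir sij) fi fj.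
by rewrite disj; [case | case: sij => /nesym].
Qed.
End Combinatorics.

Theorem theorem4p3 (R : realType) (I : countType) (X : I -> (R * R) * R)
    (hX : locally_finite_marked X) (hD : conditions_D X)
    (hchain : ~ descending_chain1 X) :
  exists f : I -> \bar R,
    unique (GMHS1 X) f /\
    unique (fun g => radius_functions g /\ T1 X g = g) f.
Proof.
have [f fU] := T1_fixpoint hX hD hchain; exists f; split => //.
have [[f0 fE] f_uniq] := fU; split; first exact: T1_fixpoint_GMHS1.
move=> g gG; apply: f_uniq; split; last exact: GMHS1_T1_fixpoint.
by case: gG => -[].
Qed.
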